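(* Let $p>1$ and let $\mathcal{H}_p$ be a generalized $p$-Laplacian on a graph $\mathcal{G}=(V,E)$. Assume that there exist an eigenfunction $f$ of $\mathcal{H}_p$ and an edge $e_0=(u_0,v_0)\in E$ such that $f(u_0),f(v_0)\ne0$. Let $\alpha=f(v_0)/f(u_0)$ and consider the operator $\mathcal{H}_p'=\mathcal{H}_p+\Xi_p$, where, for $g:V\to\mathbb{R}$, $$(\Xi_pg)(u)=\begin{cases}0 & \text{if } u\ne u_0,v_0,\\ \omega_{u_0v_0}\Big(\phi_p(1-\alpha)\phi_p(g(u_0))-\phi_p(g(u_0)-g(v_0))\Big) & \text{if } u=u_0,\\ \omega_{u_0v_0}\Big(\phi_p\big(1-\tfrac1\alpha\big)\phi_p(g(v_0))-\phi_p(g(v_0)-g(u_0))\Big) & \text{if } u=v_0.\end{cases}$$ Let $\eta_k$ be the variational eigenvalues of $\mathcal{H}_p'$ and $\lambda_k$ those of $\mathcal{H}_p$. The following inequalities hold: - if $\frac{f(v_0)}{f(u_0)}<0$, then $\eta_{k-1}\le\lambda_k\le\eta_k$; - if $\frac{f(v_0)}{f(u_0)}>0$, then $\eta_k\le\lambda_k\le\eta_{k+1}$.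
   Context: Let $\mathcal{G}=(V,E)$ be a finite undirected simple graph with $N=|V|$ nodes, positive node weights $\varrho:V\to\mathbb{R}_+$ and positive symmetric edge weights $\omega:E\to\mathbb{R}_+$; $v\sim u$ means that $uv\in E$. For $p>1$ put $\phi_p(x)=|x|^{p-2}x$ (with $\phi_p(0)=0$). Given real coefficients $\kappa_u$, $u\in V$, the generalized $p$-Laplacian is $(\mathcal{H}_p f)(u)=\sum_{v\sim u}\omega_{uv}\phi_p(f(u)-f(v))+\kappa_u\phi_p(f(u))$ for $f:V\to\mathbb{R}$. A nonzero $f$ is an eigenfunction with eigenvalue $\lambda\in\mathbb{R}$ if $(\mathcal{H}_pf)(u)=\lambda\varrho_u\phi_p(f(u))$ for all $u\in V$. Krasnoselskii genus: for a closed symmetric set $A=-A$ in $\mathbb{R}^N$, $\gamma(A)$ is the least $k\in\mathbb{N}$ such that there is a continuous odd map $\varphi:A\to\mathbb{R}^k$ with $0\notin\varphi(A)$; $\gamma(A)=\infty$ if no such $k$ exists and $\gamma(\emptyset)=0$. Let $\mathcal{S}_p=\{f:V\to\mathbb{R}:\|f\|_p=1\}$, $\mathcal{F}_k(\mathcal{S}_p)=\{A\subseteq\mathcal{S}_p: A=-A \text{ closed},\ \gamma(A)\ge k\}$, and $$\mathcal{R}_{\mathcal{H}_p}(f)=\frac{\sum_{uv\in E}\omega_{uv}|f(u)-f(v)|^p+\sum_{u\in V}\kappa_u|f(u)|^p}{\sum_{u\in V}\varrho_u|f(u)|^p}.$$ The variational eigenvalues are $\lambda_k=\min_{A\in\mathcal{F}_k(\mathcal{S}_p)}\max_{f\in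 A}\mathcal{R}_{\mathcal{H}_p}(f)$, $k=1,\dots,N$. The operator $\mathcal{H}_p'$ is the generalized $p$-Laplacian on the graph $\mathcal{G}\setminus e_0$ (same node set, same node weights $\varrho$, edge $e_0$ deleted, other edge weights unchanged) with coefficients $\kappa'_{u_0}=\kappa_{u_0}+\omega_{u_0v_0}\phi_p(1-\alpha)$, $\kappa'_{v_0}=\kappa_{v_0}+\omega_{u_0v_0}\phi_p(1-\frac1\alpha)$ and $\kappa'_u=\kappa_u$ otherwise; its variational eigenvalues $\eta_1\le\dots\le\eta_N$ are defined by the same min-max formula with $\mathcal{R}_{\mathcal{H}_p'}$. Here $k\in\{1,\dots,N\}$ and inequalities involving an index outside $\{1,\dots,N\}$ are void ($\eta_0=-\infty$, $\eta_{N+1}=+\infty$). *)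

(* Defs.v *)
(* Built on MathComp and MathComp-Analysis, over an arbitrary [R : realType]. *)
From HB Require Import structures.
From mathcomp Require Import all_boot all_order all_algebra.
From mathcomp Require Import all_classical all_reals all_analysis.
From mathcomp Require Import ring.

Set Implicit Arguments.
Unset Strict Implicit.
Unset Printing Implicit Defensive.

Import Order.TTheory GRing.Theory Num.Theory.
Import numFieldNormedType.Exports.

Local Open Scope classical_set_scope.
Local Open Scope ring_scope.

(* Only the values of [omega] on adjacent pairs matter, so its positivity and
   symmetry are required on edges only. *)
Record wgraph (R : realType) (V : finType) := WGraph {
  adj : rel V;
  omega : V -> V -> R;
  rho : V -> R;
  adj_sym : symmetric adj;
  adj_irr : irreflexive adj;
  omega_gt0 : forall u v, adj u v -> 0 < omega u v;
  omega_sym : forall u v, adj u v -> omega u v = omega v u;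
  rho_gt0 : forall u, 0 < rho u
}.

Section Operators.
Variables (R : realType) (V : finType) (p : R).
Implicit Types (G : wgraph R V) (kappa f g : V -> R) (u v : V).

Definition phi (x : R) : R := `|x| `^ (p - 2) * x.

Definition pLaplacian G kappa f u : R :=
  \sum_(v | adj G u v) omega G u v * phi (f u - f v) + kappa u * phi (f u).

Definition is_eigenfunction G kappa (lam : R) f : Prop :=
  (exists u, f u <> 0) /\
  forall u, pLaplacian G kappa f u = lam * rho G u * phi (f u).

(* Each undirected edge occurs twice in the sum over ordered adjacent pairs,
   whence the factor 1/2. *)
Definition rayleigh G kappa f : R :=
  (2^-1 * \sum_u \sum_(v | adj G u v) omega G u v * `|f u - f v| `^ p
   + \sum_u kappa u * `|f u| `^ p)
  / \sum_u rho G u * `|f u| `^ p.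

Definition lpnorm f : R := (\sum_u `|f u| `^ p) `^ p^-1.

Definition psphere : set (V -> R) := [set f | lpnorm f = 1].

Definition symmetric_set (A : set (V -> R)) : Prop :=
  forall f, A f -> A (\- f).

(* [V -> R] is topologized as the product R^V. *)
Definition closed_set (A : set (V -> R)) : Prop :=
  closed (A : set {ptws V -> R}).

Definition odd_nonvanishing (A : set {ptws V -> R}) (k : nat)
    (h : {ptws V -> R} -> 'rV[R]_k) : Prop :=
  [/\ {within A, continuous h},
      forall f, A f -> h (\- f) = - h f
    & forall f, A f -> h f <> 0].

(* The infimum of the empty set is +oo, and the unique map from the empty set
   to 'rV_0 is admissible, so that [genus set0 = 0]. *)
Definition genus (A : set (V -> R)) : \bar R :=
  ereal_inf [set (k%:R)%:E | k in
    [set k | exists h : {ptws V -> R} -> 'rV[R]_k, odd_nonvanishing A h]].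

Definition genus_family (k : nat) : set (set (V -> R)) :=
  [set A | [/\ A `<=` psphere, symmetric_set A, closed_set A
             & ((k%:R)%:E <= genus A)%E]].

(* The min-max is taken as inf-sup in the extended reals; this is the min-max
   value whenever the latter is attained. *)
Definition variational_eigenvalue G kappa (k : nat) : \bar R :=
  ereal_inf [set ereal_sup [set (rayleigh G kappa f)%:E | f in A]
            | A in genus_family k].

Definition is_edge u0 v0 u v : bool :=
  ((u == u0) && (v == v0)) || ((u == v0) && (v == u0)).

Definition del_adj G u0 v0 : rel V :=
  fun u v => adj G u v && ~~ is_edge u0 v0 u v.

Lemma del_adj_sym G u0 v0 : symmetric (del_adj G u0 v0).
Proof.
move=> u v; rewrite /del_adj /is_edge adj_sym orbC.
by congr (_ && ~~ (_ || _)); exact: andbC.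
Qed.

Lemma del_adj_irr G u0 v0 : irreflexive (del_adj G u0 v0).
Proof. by move=> u; rewrite /del_adj adj_irr. Qed.

Lemma del_omega_gt0 G u0 v0 u v : del_adj G u0 v0 u v -> 0 < omega G u v.
Proof. by case/andP => /omega_gt0. Qed.

Lemma del_omega_sym G u0 v0 u v :
  del_adj G u0 v0 u v -> omega G u v = omega G v u.
Proof. by case/andP => /omega_sym. Qed.

Definition del_edge G u0 v0 : wgraph R V :=
  WGraph (@del_adj_sym G u0 v0) (@del_adj_irr G u0 v0)
    (@del_omega_gt0 G u0 v0) (@del_omega_sym G u0 v0) (@rho_gt0 R V G).

Definition del_kappa G kappa u0 v0 (alpha : R) : V -> R := fun u =>
  if u == u0 then kappa u0 + omega G u0 v0 * phi (1 - alpha)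
  else if u == v0 then kappa v0 + omega G u0 v0 * phi (1 - alpha^-1)
  else kappa u.

Definition Xi G u0 v0 (alpha : R) g u : R :=
  if u == u0 then
    omega G u0 v0 * (phi (1 - alpha) * phi (g u0) - phi (g u0 - g v0))
  else if u == v0 then
    omega G u0 v0 * (phi (1 - alpha^-1) * phi (g v0) - phi (g v0 - g u0))
  else 0.

(* The perturbed operator H_p + Xi_p is the generalized p-Laplacian of the graph
   with the edge u0v0 deleted, with coefficients [del_kappa]. *)
Lemma pLaplacian_del_edge G kappa u0 v0 alpha g u : adj G u0 v0 ->
  pLaplacian (del_edge G u0 v0) (del_kappa G kappa u0 v0 alpha) g u =
  pLaplacian G kappa g u + Xi G u0 v0 alpha g u.
Proof.
move=> e0; have nuv : v0 != u0.
  by apply/eqP => h; move: e0; rewrite h adj_irr.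
rewrite /pLaplacian /del_kappa /Xi /=.
have [->|nu0] := eqVneq u u0.
  rewrite [in RHS](bigD1 v0) //=.
  rewrite (eq_bigl (fun v => adj G u0 v && (v != v0))); first by ring.
  move=> v; rewrite /del_adj /is_edge eqxx /= [u0 == v0]eq_sym (negbTE nuv).
  by rewrite orbF.
have [->|nv0] := eqVneq u v0.
  rewrite [in RHS](bigD1 u0) /=; last by rewrite adj_sym.
  rewrite -(omega_sym e0).
  rewrite (eq_bigl (fun v => adj G v0 v && (v != u0))); first by ring.
  by move=> v; rewrite /del_adj /is_edge eqxx /= (negbTE nuv).
rewrite addr0; congr (_ + _); apply: eq_bigl => v.
by rewrite /del_adj /is_edge (negbTE nu0) (negbTE nv0) andbT.
Qed.

End Operators.

(* Main.v *)
Require Import Defs.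
From mathcomp Require Import all_boot all_order all_algebra.
From mathcomp Require Import all_classical all_reals all_analysis.
From mathcomp Require Import ring lra.

Set Implicit Arguments.
Unset Strict Implicit.
Unset Printing Implicit Defensive.

Import Order.TTheory GRing.Theory Num.Theory.
Import numFieldNormedType.Exports.

Local Open Scope classical_set_scope.
Local Open Scope ring_scope.

(** Deleting the edge [u0 v0] and modifying [kappa] at its endpoints changes the
    numerator of the Rayleigh quotient at [g] by [omega u0 v0] times
      phi (1 - alpha) |x|^p + phi (1 - 1/alpha) |y|^p - |x - y|^p,
    where [x = g u0] and [y = g v0]; this quantity is the [edge_defect] below.
    Two facts about it give the interlacing.

    It is nonnegative if [alpha < 0] and nonpositive if [alpha > 0]
    ([edge_defect_ge0], [edge_defect_le0]).  This is the convexity of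
    [t |-> t^p], put in the homogeneous form [normpowD_le] and applied to
    whichever of [x - y = x + (- y)], [x = (x - y) + y] and [y = x + (y - x)]
    has positive weights.  The two Rayleigh quotients are therefore ordered
    everywhere, which orders [lambda k] and [eta k].

    It vanishes on the hyperplane [y = alpha x] ([edge_defect_eq0]), so both
    Rayleigh quotients agree there.  Intersecting a closed symmetric set with a
    hyperplane lowers its genus by at most one ([genus_zero_section]): an odd
    nonvanishing map on the intersection extends continuously to the whole
    space by Tietze's theorem, the odd part of the extension is still an
    extension, and adding the linear form of the hyperplane as one more
    coordinate makes the result nonvanishing on the original set.  Intersecting
    every competitor for the index [k + 1] with the hyperplane thus gives a
    competitor for the index [k] on which the other quotient takes the same
    values ([variational_eigenvalue_zero_section]).  This gives the two
    inequalities in which the index is shifted. *)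

(** * The power function and the defect of an edge *)
Section Phi.
Variables (R : realType) (p : R).
Hypothesis p_gt1 : 1 < p.
Implicit Types (a b x y : R).

Lemma phiM x y : phi p (x * y) = phi p x * phi p y.
Proof. by rewrite /phi normrM powRM// mulrACA. Qed.

Lemma phiN x : phi p (- x) = - phi p x.
Proof. by rewrite /phi normrN mulrN. Qed.

Lemma phi_gt0 x : 0 < x -> 0 < phi p x.
Proof. by move=> x0; rewrite /phi mulr_gt0// powR_gt0// gtr0_norm. Qed.

Lemma phi1 : phi p 1 = 1.
Proof. by rewrite /phi normr1 powR1 mulr1. Qed.

Lemma phi_mulr x : phi p x * x = `|x| `^ p.
Proof.
have [->|x0] := eqVneq x 0.
  by rewrite mulr0 normr0 powR0// gt_eqF// (lt_trans _ p_gt1).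
rewrite /phi -mulrA -expr2 -real_normK ?num_real// -powR_mulrn//.
rewrite -powRD; first by congr (_ `^ _); ring.
by apply/implyP; rewrite normr_eq0.
Qed.

Lemma normpowM x y : `|x * y| `^ p = `|x| `^ p * `|y| `^ p.
Proof. by rewrite normrM powRM. Qed.

(** Convexity of [t |-> t^p] at [x / a] and [y / b] with the weights
    [a / (a + b)] and [b / (a + b)].  Equality holds when [x / a = y / b]; in
    each of the splittings used for the edge defect this is the hyperplane
    [y = alpha x]. *)
Lemma normpowD_le a b x y : 0 < a -> 0 < b ->
  `|x + y| `^ p / phi p (a + b) <= `|x| `^ p / phi p a + `|y| `^ p / phi p b.
Proof.
move=> a0 b0; have ab0 : 0 < a + b by rewrite addr_gt0.
have p0 : 0 <= p by rewrite ltW// (lt_trans _ p_gt1).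
pose t := a / (a + b).
have t0 : 0 <= t by rewrite divr_ge0 ?ltW.
have t1 : t <= 1 by rewrite ler_pdivrMr// mul1r lerDl ltW.
(* [convex_powR] is about nonnegative arguments, hence the absolute values. *)
have := convex_powR (ltW p_gt1) (Itv01 t0 t1)
  (x := `|x| / a) (y := `|y| / b).
rewrite !inE /= !in_itv /= !andbT !divr_ge0 ?(ltW a0) ?(ltW b0)//.
move=> /(_ isT isT).
rewrite convRE [X in X `^ _ <= _]convRE /=.
have normpow_div (z c : R) : 0 < c ->
    (`|z| / c) `^ p = `|z| `^ p / (phi p c * c).
  move=> c0; apply/(canRL (mulfK _)).
    by rewrite gt_eqF// mulr_gt0// phi_gt0.
  rewrite phi_mulr (gtr0_norm c0) -powRM ?divr_ge0// ?ltW//.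
  by rewrite mulfVK// gt_eqF.
have -> : t * (`|x| / a) + unstable.onem t * (`|y| / b) =
    `| `|x| + `|y| | / (a + b).
  rewrite [`| _ + _ |]ger0_norm ?addr_ge0// /unstable.onem /t; field.
  by rewrite !gt_eqF.
rewrite !normpow_div// => H.
have : `|x + y| `^ p / (phi p (a + b) * (a + b)) <=
  t * (`|x| `^ p / (phi p a * a)) +
  unstable.onem t * (`|y| `^ p / (phi p b * b)).
  apply: le_trans H; rewrite ler_wpM2r//.
    by rewrite invr_ge0 mulr_ge0// ltW// phi_gt0.
  apply: (ge0_ler_powR p0); rewrite ?nnegrE//.
  by rewrite [leRHS]ger0_norm ?addr_ge0// ler_normD.
rewrite -(ler_pM2r ab0); congr (_ <= _); rewrite /t /unstable.onem; field.
  by rewrite !gt_eqF// phi_gt0.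
by rewrite !gt_eqF// phi_gt0.
Qed.

Definition edge_defect alpha x y :=
  phi p (1 - alpha) * `|x| `^ p + phi p (1 - alpha^-1) * `|y| `^ p
  - `|x - y| `^ p.

(** By homogeneity the defect at [(x, alpha x)] is [|x|^p] times its value at
    [(1, alpha)], where the two [phi] terms add up to [|1 - alpha|^p]. *)
Lemma edge_defect_eq0 (alpha x : R) :
  alpha != 0 -> edge_defect alpha x (alpha * x) = 0.
Proof.
move=> a0; rewrite /edge_defect.
have -> : x - alpha * x = (1 - alpha) * x by rewrite mulrBl mul1r.
rewrite !normpowM -!phi_mulr.
have : phi p (1 - alpha^-1) * phi p alpha = - phi p (1 - alpha).
  by rewrite -phiM -phiN mulrBl mulVf// mul1r opprB.
move: (phi p (1 - alpha^-1)) (phi p alpha) (phi p (1 - alpha)) => u v w uvE.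
have -> : w = - (u * v) by rewrite uvE opprK.
by ring.
Qed.

(** As [phi] is odd and multiplicative, [phi (1 - 1/alpha)] equals
    [- phi (1 - alpha) / phi alpha]; this brings the defect to the shape of
    [normpowD_le]. *)
Lemma edge_defectE alpha x y : alpha != 0 ->
  edge_defect alpha x y =
  phi p (1 - alpha) * (`|x| `^ p - `|y| `^ p / phi p alpha) - `|x - y| `^ p.
Proof.
move=> a0; have pa0 : phi p alpha != 0.
  by rewrite /phi mulf_neq0// gt_eqF// powR_gt0// normr_gt0.
rewrite /edge_defect.
rewrite (_ : phi p (1 - alpha) = - (phi p (1 - alpha^-1) * phi p alpha)).
  by field.
by rewrite -phiM -phiN mulrBl mulVf// mul1r opprB.
Qed.

(** Split [x - y = x + (- y)] with weights [1] and [- alpha]. *)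
Lemma edge_defect_ge0 alpha x y : alpha < 0 -> 0 <= edge_defect alpha x y.
Proof.
move=> a0; have Na0 : 0 < - alpha by rewrite oppr_gt0.
have w0 : 0 < phi p (1 - alpha) by apply: phi_gt0; rewrite addr_gt0.
rewrite edge_defectE ?lt_eqF// subr_ge0 mulrC -ler_pdivrMr//.
have := normpowD_le x (- y) ltr01 Na0.
by rewrite normrN phi1 divr1 (phiN alpha) invrN mulrN.
Qed.

(** If [alpha < 1], split [x = (x - y) + y] with weights [1 - alpha] and
    [alpha]; if [alpha > 1], split [y = x + (y - x)] with weights [1] and
    [alpha - 1].  For [alpha = 1] only [- |x - y|^p] remains. *)
Lemma edge_defect_le0 alpha x y : 0 < alpha -> edge_defect alpha x y <= 0.
Proof.
move=> a0; rewrite edge_defectE ?gt_eqF// subr_le0.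
have [a1|a1|->] := ltgtP alpha 1.
- have b0 : 0 < 1 - alpha by rewrite subr_gt0.
  have := normpowD_le (x - y) y b0 a0.
  by rewrite !subrK phi1 divr1 -lerBlDr ler_pdivlMr ?phi_gt0// mulrC.
- have b0 : 0 < alpha - 1 by rewrite subr_gt0.
  have := normpowD_le x (y - x) ltr01 b0.
  rewrite !subrKC phi1 divr1 -lerBlDl ler_pdivlMr ?phi_gt0// distrC.
  by rewrite mulrC -mulrNN -phiN !opprB.
- by rewrite subrr /phi mulr0 mul0r powR_ge0.
Qed.

End Phi.

(** * Genus and zero sets of odd functions *)

Section Squash.
Variable R : realType.
Implicit Type x : R.

(** An odd homeomorphism onto a bounded interval: applied to each coordinate it
    keeps a map odd and nonvanishing and makes it bounded, as the extension
    theorem requires. *)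
Definition squash (x : R) : R := x / (1 + `|x|).

Lemma squash_continuous : continuous (squash : R -> R).
Proof.
move=> x; apply: cvgM; first exact: cvg_id.
apply: cvgV; first by rewrite gt_eqF// ltr_pwDl.
apply: cvgD; first exact: cvg_cst.
exact: norm_continuous.
Qed.

Lemma squash_bound x : `|squash x| <= 1.
Proof.
rewrite /squash normrM normfV [X in _ / X]ger0_norm; last by rewrite addr_ge0.
by rewrite ler_pdivrMr ?ltr_pwDl// mul1r lerDr.
Qed.

Lemma squashN x : squash (- x) = - squash x.
Proof. by rewrite /squash normrN mulNr. Qed.

Lemma squash_eq0 x : (squash x == 0) = (x == 0).
Proof.
by rewrite /squash mulf_eq0 invr_eq0 [_ + _ == 0]gt_eqF ?orbF// ltr_pwDl.
Qed.

End Squash.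

Section Genus.
Variables (R : realType) (V : finType).
Implicit Types (A : set (V -> R)) (l : {ptws V -> R} -> R).
Local Notation X := {ptws V -> R}.

Lemma ptws_continuous (T : topologicalType) (h : T -> X) :
  (forall v, continuous (fun x => h x v)) -> continuous h.
Proof.
move=> hc x; apply/cvg_sup => v U [/= _ [[W oW <-] /= Whx]] /filterS; apply.
by apply: (hc v); exact: open_nbhs_nbhs.
Qed.

Lemma ptws_opp_continuous : continuous (fun f : X => (\- f) : X).
Proof.
apply: ptws_continuous => v f.
apply: (@continuous_comp X R R (fun g => g v) -%R); last exact: opp_continuous.
exact: proj_continuous.
Qed.

Lemma row_continuous (T : topologicalType) n (h : T -> 'rV[R]_n) :
  (forall j, continuous (fun x => h x ord0 j)) -> continuous h.
Proof.
move=> hc x B [P hP PB].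
apply: (@filterS _ _ _ [set y | forall j, P ord0 j (h y ord0 j)]).
  move=> y hy; apply: PB => i j; rewrite ord1; exact: hy.
apply: filter_forall => j; apply: (hc j x); exact: hP.
Qed.

(** [V] is finite, so the product topology is metrizable. *)
Lemma ptws_normal : normal_space X.
Proof. exact: (@pseudometric_normal R X). Qed.

Lemma closed_zero_section A l : closed_set A -> continuous l ->
  closed_set (A `&` [set f | l f = 0]).
Proof.
move=> clA cl; apply: closedI; first exact: clA.
apply: (@preimage_closed _ _ l [set 0]) => [f _|]; first exact: cl.
exact: closed_eq.
Qed.

(** The new map has [l] as its first coordinate.  The others are twice the odd
    parts of extensions of the squashed coordinates of [h]: where [l] vanishes
    they do not all vanish, because [h] does not, and elsewhere [l] does the
    job. *)
Lemma odd_nonvanishing_zero_section A l (k : nat) (h : X -> 'rV[R]_k) :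
  closed_set A -> symmetric_set A -> continuous l ->
  (forall f, l (\- f) = - l f) ->
  odd_nonvanishing (A `&` [set f | l f = 0] : set X) h ->
  exists h' : X -> 'rV[R]_k.+1, odd_nonvanishing (A : set X) h'.
Proof.
move=> clA symA cl lN [ch hN h0].
set B : set X := A `&` _ in ch hN h0.
have clB : closed B by exact: closed_zero_section.
have symB f : B f -> B (\- f).
  by move=> [/symA Af lf]; split=> //; rewrite /= lN lf oppr0.
have ext j : exists g : X -> R,
    {in B, (fun f => squash (h f ord0 j)) =1 g} /\ continuous g.
  have ch' : {within B, continuous (fun f => squash (h f ord0 j) : R^o)}.
    move=> f; apply: (@continuous_comp _ _ _ (h : subspace B -> _)
      (fun M : 'rV[R]_k => squash (M ord0 j))); first exact: ch.
    apply: (@continuous_comp _ _ _ (fun M : 'rV[R]_k => M ord0 j)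
      (@squash R)).
      exact: coord_continuous.
    exact: squash_continuous.
  have [f _|g [hg cg _]] := @continuous_bounded_extension X R ptws_normal B
    clB (fun f => squash (h f ord0 j)) 1 ltr01 ch'; first exact: squash_bound.
  by exists g.
pose g j := projT1 (cid (ext j)).
have gB j f : B f -> g j f = squash (h f ord0 j).
  move=> Bf; have [-> //] := projT2 (cid (ext j)); exact/mem_set.
have gc j : continuous (g j) by have [_] := projT2 (cid (ext j)).
pose h' f : 'rV[R]_k.+1 :=
  \row_j oapp (fun i => g i f - g i (\- f)) (l f) (unlift ord0 j).
exists h'; split.
- apply: continuous_subspaceT; apply: row_continuous => j.
  have -> : (fun f => h' f ord0 j) =
      oapp (fun i f => g i f - g i (\- f)) l (unlift ord0 j).
    by apply/funext => f; rewrite mxE; case: unlift.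
  case: unlift => [i|] //= f.
  apply: (@continuousB R R^o X (g i) (fun f => g i (\- f)) f); first exact: gc.
  apply: (@continuous_comp _ _ _ (fun f : X => (\- f) : X) (g i)).
    exact: ptws_opp_continuous.
  exact: gc.
- move=> f _; apply/rowP => j; rewrite !mxE; case: unlift => [i|] /=.
    by rewrite opprB; congr (_ - g i _); apply/funext => v; rewrite /= opprK.
  exact: lN.
- move=> f Af /rowP h'0; have lf : l f = 0.
    by have := h'0 ord0; rewrite !mxE unlift_none.
  have Bf : B f by [].
  apply: (h0 f Bf); apply/rowP => i.
  have := h'0 (lift ord0 i); rewrite !mxE liftK /= !gB//; last exact: symB.
  rewrite hN// !mxE squashN opprK -mulr2n => /eqP.
  by rewrite mulrn_eq0 /= squash_eq0 => /eqP.
Qed.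

Lemma genus_zero_section A l k :
  closed_set A -> symmetric_set A -> continuous l ->
  (forall f, l (\- f) = - l f) ->
  (k.+1%:R%:E <= genus A)%E ->
  (k%:R%:E <= genus (A `&` [set f | l f = 0%R]))%E.
Proof.
move=> clA symA cl lN kA; apply: le_ereal_inf_tmp => _ [j [h oh] <-].
have [h' oh'] := odd_nonvanishing_zero_section clA symA cl lN oh.
have : (k.+1%:R%:E <= (j.+1%:R : R)%:E)%E.
  apply: le_trans kA _; apply: ereal_inf_lbound.
  by exists j.+1 => //; exists h'.
by rewrite !lee_fin !ler_nat.
Qed.

Lemma genus_family_zero_section p k A l :
  continuous l -> (forall f, l (\- f) = - l f) ->
  genus_family p k.+1 A -> genus_family p k (A `&` [set f | l f = 0]).
Proof.
move=> cl lN [sA symA clA kA]; split.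
- by move=> f [/sA].
- by move=> f [/symA Af lf]; split=> //; rewrite /= lN lf oppr0.
- exact: closed_zero_section.
- exact: genus_zero_section.
Qed.

End Genus.

(** * Comparison of min-max values *)

Section MinMax.
Variables (R : realType) (V : finType) (p : R).
Implicit Types (G : wgraph R V) (kappa : V -> R).

Lemma le_variational_eigenvalue G kappa G' kappa' k :
  (forall f, rayleigh p G kappa f <= rayleigh p G' kappa' f) ->
  (variational_eigenvalue p G kappa k <=
   variational_eigenvalue p G' kappa' k)%E.
Proof.
move=> le_GG'; apply: le_ereal_inf_tmp => _ [A Ak <-].
apply: ge_ereal_inf.
exists (ereal_sup [set (rayleigh p G kappa f)%:E | f in A]).
  by exists A.
apply: ge_ereal_sup => _ [f Af <-]; apply: le_ereal_sup_tmp.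
by exists (rayleigh p G' kappa' f)%:E; [exists f|rewrite lee_fin].
Qed.

(** Competitors for the index [k + 1] meet the zero set of [l] in competitors
    for the index [k], so it is enough to compare the quotients there. *)
Lemma variational_eigenvalue_zero_section G kappa G' kappa' k
    (l : {ptws V -> R} -> R) :
  continuous l -> (forall f, l (\- f) = - l f) ->
  (forall f, l f = 0 -> rayleigh p G kappa f <= rayleigh p G' kappa' f) ->
  (variational_eigenvalue p G kappa k <=
   variational_eigenvalue p G' kappa' k.+1)%E.
Proof.
move=> cl lN le_GG'; apply: le_ereal_inf_tmp => _ [A Ak <-].
apply: ge_ereal_inf; exists (ereal_sup
    [set (rayleigh p G kappa f)%:E | f in A `&` [set f | l f = 0%R]]).
  by exists (A `&` [set f | l f = 0]) => //; exact: genus_family_zero_section.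
apply: ge_ereal_sup => _ [f [Af lf] <-]; apply: le_ereal_sup_tmp.
by exists (rayleigh p G' kappa' f)%:E; [exists f|rewrite lee_fin le_GG'].
Qed.

End MinMax.
(** * Rayleigh quotient after deletion of an edge *)

Section DeleteEdge.
Variables (R : realType) (V : finType) (p : R).
Implicit Types (G : wgraph R V) (kappa g : V -> R).

Lemma sum_del_adj G u0 v0 (F : V -> V -> R) : adj G u0 v0 ->
  \sum_u \sum_(v | adj G u v) F u v =
  \sum_u \sum_(v | del_adj G u0 v0 u v) F u v + (F u0 v0 + F v0 u0).
Proof.
move=> e0; have nuv : v0 != u0.
  by apply/eqP => h; move: e0; rewrite h adj_irr.
rewrite [RHS]addrC.
under eq_bigr => u _ do rewrite (bigID (is_edge u0 v0 u)) /=.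
rewrite big_split /=; congr (_ + _).
rewrite (bigD1 u0)//= [X in _ + X](bigD1 v0)//=.
rewrite [X in _ + (_ + X)]big1 ?addr0; last first.
  move=> u /andP[uu0 uv0]; apply: big_pred0 => v.
  by rewrite /is_edge (negbTE uu0) (negbTE uv0) andbF.
congr (_ + _); apply: big_pred1 => v; rewrite /is_edge !eqxx ?(negbTE nuv)
  ?[u0 == v0]eq_sym ?(negbTE nuv) /= ?orbF.
  by have [->|] := eqVneq v v0; rewrite ?e0 ?andbF.
by have [->|] := eqVneq v u0; rewrite 1?adj_sym ?e0 ?andbF.
Qed.

Lemma rayleigh_del_edge G kappa u0 v0 alpha g : adj G u0 v0 ->
  rayleigh p (del_edge G u0 v0) (del_kappa p G kappa u0 v0 alpha) g =
  rayleigh p G kappa g +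
  omega G u0 v0 * edge_defect p alpha (g u0) (g v0)
    / \sum_u rho G u * `|g u| `^ p.
Proof.
move=> e0; have nuv : v0 != u0.
  by apply/eqP => h; move: e0; rewrite h adj_irr.
rewrite /rayleigh -mulrDl; congr (_ / _).
rewrite (sum_del_adj (fun u v => omega G u v * `|g u - g v| `^ p) e0) /=.
rewrite -(omega_sym e0) [`|g v0 - g u0|]distrC.
have -> : \sum_u del_kappa p G kappa u0 v0 alpha u * `|g u| `^ p =
    \sum_u kappa u * `|g u| `^ p + omega G u0 v0 *
      (phi p (1 - alpha) * `|g u0| `^ p + phi p (1 - alpha^-1) * `|g v0| `^ p).
  rewrite [LHS](bigD1 u0)//= [X in _ + X = _](bigD1 v0)//=.
  rewrite [in RHS](bigD1 u0)//= [X in _ = _ + X + _](bigD1 v0)//=.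
  rewrite {1 2}/del_kappa !eqxx (negbTE nuv).
  rewrite [X in _ + (_ + X) = _](eq_bigr (fun u => kappa u * `|g u| `^ p)).
    by ring.
  by move=> u /andP[uu0 uv0]; rewrite /del_kappa (negbTE uu0) (negbTE uv0).
by rewrite /edge_defect; field.
Qed.

End DeleteEdge.

Theorem lemma5p2 (R : realType) (V : finType) (p : R) (hp : 1 < p)
    (G : wgraph R V) (kappa : V -> R)
    (f : V -> R) (mu : R) (hf : is_eigenfunction p G kappa mu f)
    (u0 v0 : V) (he : adj G u0 v0) (hu : f u0 <> 0) (hv : f v0 <> 0) :
  let alpha := f v0 / f u0 in
  let lambda := variational_eigenvalue p G kappa in
  let eta := variational_eigenvalue p (del_edge G u0 v0)
               (del_kappa p G kappa u0 v0 alpha) in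
  (alpha < 0 -> forall k : nat, (1 <= k <= #|V|)%N ->
     ((1 < k)%N -> (eta k.-1 <= lambda k)%E) /\ (lambda k <= eta k)%E) /\
  (0 < alpha -> forall k : nat, (1 <= k <= #|V|)%N ->
     (eta k <= lambda k)%E /\ ((k < #|V|)%N -> (lambda k <= eta k.+1)%E)).
Proof.
move=> alpha lambda eta.
have alpha0 : alpha != 0 by rewrite mulf_neq0 ?invr_eq0//; apply/eqP.
(* The zero set of [l] is the hyperplane on which the edge defect vanishes. *)
pose l (g : {ptws V -> R}) : R := g v0 - alpha * g u0.
have cl : continuous l.
  move=> g; apply: (@continuousB R R^o _ (fun g : {ptws V -> R} => g v0)
    (fun g => alpha * g u0) g); first exact: proj_continuous.
  apply: (@continuousM _ _ (fun=> alpha) (fun g : {ptws V -> R} => g u0)).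
    exact: cst_continuous.
  exact: proj_continuous.
have lN g : l (\- g) = - l g by rewrite /l /=; ring.
have l_eq g : l g = 0 ->
    rayleigh p (del_edge G u0 v0) (del_kappa p G kappa u0 v0 alpha) g =
    rayleigh p G kappa g.
  move=> /eqP; rewrite subr_eq0 => /eqP gv0.
  by rewrite rayleigh_del_edge// gv0 edge_defect_eq0// mulr0 mul0r addr0.
have w0 (g : V -> R) : 0 <= omega G u0 v0 / \sum_u rho G u * `|g u| `^ p.
  rewrite divr_ge0 ?(ltW (omega_gt0 he))// sumr_ge0// => u _.
  by rewrite mulr_ge0 ?powR_ge0// ltW// rho_gt0.
split=> [a0|a0] [|k] _ //; split.
- case: k => [//|k] _.
  by apply: (variational_eigenvalue_zero_section _ cl lN) => g /l_eq ->.
- apply: le_variational_eigenvalue => g.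
  by rewrite rayleigh_del_edge// lerDl mulrAC mulr_ge0// edge_defect_ge0.
- apply: le_variational_eigenvalue => g.
  by rewrite rayleigh_del_edge// gerDl mulrAC mulr_ge0_le0// edge_defect_le0.
- move=> _; apply: (variational_eigenvalue_zero_section _ cl lN) => g.
  by move=> /l_eq ->.
Qed.
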